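(* Let $\kappa\colon\mathcal{Y}\to\mathcal{X}$ be a lumping function, and let $\Phi\colon\mathcal{W}(\mathcal{X},\mathcal{D})\to\mathcal{W}(\mathcal{Y},\mathcal{E})$ be the $\kappa$-compatible exponential embedding with origin $P_\odot\in\mathcal{W}_\kappa(\mathcal{Y},\mathcal{E})$. (i) $\Phi$ is an e-geodesic affine map: for all $\bar P_0,\bar P_1\in\mathcal{W}(\mathcal{X},\mathcal{D})$ and $t\in\mathbb{R}$, $\Phi\,\gamma^{(e)}_{\bar P_0,\bar P_1}(t)=\gamma^{(e)}_{\Phi\bar P_0,\Phi\bar P_1}(t)$. (ii) $\Phi$ is generally not an m-geodesic affine map: there exist a strongly connected digraph $(\mathcal{Y},\mathcal{E})$, a lumping function $\kappa\colon\mathcal{Y}\to\mathcal{X}$ with $\mathcal{D}=\{(\kappa(y),\kappa(y')):(y,y')\in\mathcal{E}\}$, and an origin $P_\odot\in\mathcal{W}_\kappa(\mathcal{Y},\mathcal{E})$ for which the $\kappa$-compatible exponential embedding $\Phi\colon\mathcal{W}(\mathcal{X},\mathcal{D})\to\mathcal{W}(\mathcal{Y},\mathcal{E})$ with origin $P_\odot$ is not m-geodesic affine.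
   Context: All vertex sets are finite with at least two elements. $(\mathcal{Y},\mathcal{E})$ is a strongly connected digraph; a lumping function is a surjective map $\kappa\colon\mathcal{Y}\to\mathcal{X}$; $\mathcal{S}_x=\kappa^{-1}(\{x\})$, $\mathcal{D}=\{(\kappa(y),\kappa(y')):(y,y')\in\mathcal{E}\}$. $\mathcal{F}_+(\mathcal{Y},\mathcal{E})$ is the set of matrices on $\mathcal{Y}$ strictly positive on $\mathcal{E}$ and zero outside; $\mathcal{W}(\mathcal{Y},\mathcal{E})$ is the set of row-stochastic matrices in $\mathcal{F}_+(\mathcal{Y},\mathcal{E})$ (similarly for $(\mathcal{X},\mathcal{D})$). $P\in\mathcal{W}(\mathcal{Y},\mathcal{E})$ is $\kappa$-lumpable if $\sum_{y'\in\mathcal{S}_{x'}}P(y_1,y')=\sum_{y'\in\mathcal{S}_{x'}}P(y_2,y')$ for all $x,x'\in\mathcal{X}$, $y_1,y_2\in\mathcal{S}_x$; $\mathcal{W}_\kappa(\mathcal{Y},\mathcal{E})$ is the set of such $P$. Stochastic rescaling: for $A\in\mathcal{F}_+(\mathcal{Y},\mathcal{E})$ with Perron–Frobenius root $\rho_A$ and positive right Perron–Frobenius eigenvector $v_A$, $\mathfrak{s}(A)(y,y')=\frac{A(y,y')v_A(y')}{\rho_Av_A(y)}$, an element of $\mathcal{W}(\mathcal{Y},\mathcal{E})$. Exponential embedding with origin $P_\odot\in\mathcal{W}_\kappa(\mathcal{Y},\mathcal{E})$: $\Phi\bar P=\mathfrak{s}(\tilde P)$ with $\tilde P(y,y')=P_\odot(y,y')\bar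 P(\kappa(y),\kappa(y'))$. Geodesics: for $P_0,P_1\in\mathcal{W}(\mathcal{Y},\mathcal{E})$, $\gamma^{(e)}_{P_0,P_1}(t)=\mathfrak{s}(A_t)$, $t\in\mathbb{R}$, where $A_t(y,y')=P_0(y,y')^{1-t}P_1(y,y')^t$ on $\mathcal{E}$ and $0$ elsewhere. With edge measures $Q_i(y,y')=\pi_i(y)P_i(y,y')$ ($\pi_i$ the stationary distribution of $P_i$) and $Q_t=(1-t)Q_0+tQ_1$, $\gamma^{(m)}_{P_0,P_1}(t)$ is the unique element of $\mathcal{W}(\mathcal{Y},\mathcal{E})$ with edge measure $Q_t$, defined for $t\in I=\{t\in\mathbb{R}:Q_t>0\text{ on }\mathcal{E}\}\supset[0,1]$. A map $E\colon\mathcal{W}(\mathcal{X},\mathcal{D})\to\mathcal{W}(\mathcal{Y},\mathcal{E})$ is m-geodesic affine if $E\,\gamma^{(m)}_{P_0,P_1}=\gamma^{(m)}_{EP_0,EP_1}$ for all $P_0,P_1\in\mathcal{W}(\mathcal{X},\mathcal{D})$. *)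

(* Defs.v *)
From HB Require Import structures.
From mathcomp Require Import all_boot all_order all_algebra.
From mathcomp Require Import complex.
From mathcomp Require Import all_classical all_reals all_analysis.

Set Implicit Arguments.
Unset Strict Implicit.
Unset Printing Implicit Defensive.

Import Order.TTheory GRing.Theory Num.Theory.
Local Open Scope ring_scope.

Section Digraph.
Variables (R : realType) (Y : finType).
Implicit Types (E : rel Y) (A P : Y -> Y -> R) (v p : Y -> R).

Definition strongly_connected E : Prop := forall y y', connect E y y'.

Definition Fplus E A : Prop :=
  (forall y y', E y y' -> 0 < A y y') /\
  (forall y y', ~~ E y y' -> A y y' = 0).

Definition W E P : Prop :=
  Fplus E P /\ forall y, \sum_y' P y y' = 1.

Definition complex_eigenvalue A (l : R[i]) : Prop :=
  exists2 u : Y -> R[i], (exists y, u y != 0) &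
    forall y, \sum_y' (A y y')%:C%C * u y' = l * u y.

Definition is_PF_root A (r : R) : Prop :=
  complex_eigenvalue A r%:C%C /\
  forall l : R[i], complex_eigenvalue A l -> `|l| <= r%:C%C.

(* [xget] picks an element of the given set; its first argument is a dummy
   value for the empty set, which does not occur when A is nonnegative and
   irreducible. *)
Definition PF_root A : R := xget 0 (is_PF_root A).

Definition is_PF_vector A v : Prop :=
  (forall y, 0 < v y) /\
  forall y, \sum_y' A y y' * v y' = PF_root A * v y.

(* Unique up to a positive factor, which cancels in [stoch_rescaling]. *)
Definition PF_vector A : Y -> R := xget (fun=> 0) (is_PF_vector A).

Definition stoch_rescaling A : Y -> Y -> R := fun y y' =>
  A y y' * PF_vector A y' / (PF_root A * PF_vector A y).

Definition e_geodesic E P0 P1 (t : R) : Y -> Y -> R :=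
  stoch_rescaling (fun y y' =>
    if E y y' then P0 y y' `^ (1 - t) * P1 y y' `^ t else 0).

Definition is_stationary P p : Prop :=
  [/\ forall y, 0 <= p y, \sum_y p y = 1 &
      forall y', \sum_y p y * P y y' = p y'].

Definition stationary P : Y -> R := xget (fun=> 0) (is_stationary P).

Definition edge_measure P : Y -> Y -> R := fun y y' =>
  stationary P y * P y y'.

Definition m_segment P0 P1 (t : R) : Y -> Y -> R := fun y y' =>
  (1 - t) * edge_measure P0 y y' + t * edge_measure P1 y y'.

Definition m_domain E P0 P1 (t : R) : Prop :=
  forall y y', E y y' -> 0 < m_segment P0 P1 t y y'.

(* Meaningful only for t in [m_domain E P0 P1]. *)
Definition m_geodesic E P0 P1 (t : R) : Y -> Y -> R :=
  xget (fun _ _ => 0)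
    (fun P => W E P /\ edge_measure P = m_segment P0 P1 t).

End Digraph.

Section Lumping.
Variables (R : realType) (Y X : finType).
Implicit Types (E : rel Y) (D : rel X) (k : Y -> X).

Definition lumping_function k : Prop := forall x, exists y, k y = x.

Definition fibre k (x : X) : {set Y} := finset (fun y => k y == x).

Definition lumped_edges k E : rel X := fun x x' =>
  [exists y, exists y', [&& E y y', k y == x & k y' == x']].

Definition W_lumpable k E (P : Y -> Y -> R) : Prop :=
  W E P /\
  forall x x' y1 y2, y1 \in fibre k x -> y2 \in fibre k x ->
    \sum_(y' in fibre k x') P y1 y' = \sum_(y' in fibre k x') P y2 y'.

Definition exp_embedding k (Po : Y -> Y -> R) (Pb : X -> X -> R) :
    Y -> Y -> R :=
  stoch_rescaling (fun y y' => Po y y' * Pb (k y) (k y')).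

Definition e_geodesic_affine D E (F : (X -> X -> R) -> (Y -> Y -> R)) : Prop :=
  forall P0 P1, W D P0 -> W D P1 -> forall t : R,
    F (e_geodesic D P0 P1 t) = e_geodesic E (F P0) (F P1) t.

(* The two curves may have different domains; they are compared at every
   parameter where both are defined, in particular on [0, 1]. *)
Definition m_geodesic_affine D E (F : (X -> X -> R) -> (Y -> Y -> R)) : Prop :=
  forall P0 P1, W D P0 -> W D P1 -> forall t : R,
    m_domain D P0 P1 t -> m_domain E (F P0) (F P1) t ->
    F (m_geodesic D P0 P1 t) = m_geodesic E (F P0) (F P1) t.

End Lumping.

(* Main.v *)
(* Stochastic rescaling of [A] multiplies [A y y'] by [c * f y' / f y] with
   [c > 0] and [f > 0], and by Perron-Frobenius its value only depends on the
   class of [A] modulo such factors.  These factors are preserved by pullback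
   along [k], by entrywise multiplication with the origin and by entrywise
   weighted geometric means, so the two sides of e-affinity are rescalings of
   equivalent matrices. *)
Require Import Defs.
From mathcomp Require Import all_boot all_order all_algebra.
From mathcomp Require Import complex ring lra.
From mathcomp Require Import all_classical all_reals all_analysis.

Set Implicit Arguments.
Unset Strict Implicit.
Unset Printing Implicit Defensive.

Import Order.TTheory GRing.Theory Num.Theory.
Import numFieldNormedType.Exports.
Local Open Scope ring_scope.

(** * Closed sets cut out by continuous inequalities *)

Lemma closed_le_continuous (R : realType) (T : topologicalType)
    (f g : T -> R) :
  continuous f -> continuous g -> closed [set x | f x <= g x]%classic.
Proof.
move=> cf cg.
rewrite (_ : [set x | _]%classic = (g \- f) @^-1` [set z | 0 <= z])%classic.
  apply: preimage_closed; last exact: closed_ge.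
  by move=> x _; apply: cvgB; [exact: cg|exact: cf].
by apply/seteqP; split=> x /=; rewrite subr_ge0.
Qed.

(** * Perron-Frobenius theory for nonnegative irreducible matrices *)

Section PerronFrobenius.
Variables (R : realType) (Y : finType) (E : rel Y) (A : Y -> Y -> R).
Hypotheses (E_conn : strongly_connected E) (FA : Fplus E A).
Implicit Types (v w : Y -> R) (r c : R).

Let app v : Y -> R := fun y => \sum_y' A y y' * v y'.

Lemma Fplus_ge0 y y' : 0 <= A y y'.
Proof.
by case: FA => A0 An; have [/A0/ltW|/An->] := boolP (E y y').
Qed.

Let app_ge0 v : (forall y, 0 <= v y) -> forall y, 0 <= app v y.
Proof. by move=> v0 y; apply: sumr_ge0 => z _; rewrite mulr_ge0 ?Fplus_ge0. Qed.

Let app_gt0 v y y' : (forall y, 0 <= v y) -> E y y' -> 0 < v y' -> 0 < app v y.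
Proof.
move=> v0 Eyy' v'0; rewrite /app (bigD1 y') //= ltr_pwDl //.
  by rewrite mulr_gt0 //; apply FA.1.
by apply: sumr_ge0 => z _; rewrite mulr_ge0 ?Fplus_ge0.
Qed.

(** Positivity travels backwards along edges: if [E y y'] and [v y'] is positive, then so is
    [app v y = r * v y], which excludes [v y = 0]. A path leads from any vertex to one where [v] is
    nonzero. *)
Lemma eigenvector_pos r v : (forall y, 0 <= v y) ->
  (forall y, app v y = r * v y) -> (exists y, v y != 0) ->
  forall y, 0 < v y.
Proof.
move=> v0 Av [z vz] y; rewrite lt_def v0 andbT.
have /connectP[p] := E_conn y z.
elim: p y => [|y' p IH] y /=; first by move=> _ <-.
case/andP=> Eyy' py' zE; apply/negP => /eqP vy.
have v'0 : 0 < v y' by rewrite lt_def v0 andbT; exact: IH.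
by have := app_gt0 v0 Eyy' v'0; rewrite Av vy mulr0 ltxx.
Qed.

(** With [c] the minimum of [w / v], the eigenvector [w - c * v] is nonnegative and vanishes at the
    minimiser, so by [eigenvector_pos] it is zero. *)
Lemma eigenvector_unique r v w : (forall y, 0 < v y) -> (forall y, 0 < w y) ->
  (forall y, app v y = r * v y) -> (forall y, app w y = r * w y) ->
  exists2 c, 0 < c & forall y, w y = c * v y.
Proof.
move=> v0 w0 Av Aw.
have [y0 _|Y0] := pickP (mem Y); last first.
  by exists 1 => // y; have := Y0 y.
have [y _ ymin] := arg_minP (fun y => w y / v y) (erefl (y0 \in Y)).
set c := w y / v y in ymin.
have c0 : 0 < c by rewrite divr_gt0.
exists c => // y'; apply/eqP; rewrite -subr_eq0; apply/negP => /negP wcv.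
have d0 x : 0 <= w x - c * v x by rewrite subr_ge0 -ler_pdivlMr ?ymin.
have := @eigenvector_pos r (fun x => w x - c * v x) d0.
have Ad x : app (fun x => w x - c * v x) x = r * (w x - c * v x).
  rewrite mulrBr -Aw mulrCA -Av mulr_sumr -sumrB.
  by apply: eq_bigr => z _; ring.
move=> /(_ Ad (ex_intro _ y' wcv) y).
by rewrite divfK ?gt_eqF// subrr ltxx.
Qed.

(** Let [c] be the maximum of [|u| / v], attained at [y]. The triangle inequality in row [y] gives
    [|l| * (c * v y) <= c * app v y = r * (c * v y)]. *)
Lemma complex_eigenvalue_le r v : (forall y, 0 < v y) ->
  (forall y, app v y = r * v y) ->
  forall l : R[i], complex_eigenvalue A l -> `|l| <= r%:C%C.
Proof.
move=> v0 Av l [u [y0 uy0] Au].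
pose m (z : R[i]) := complex.Re `|z|.
have mE z : `|z| = (m z)%:C%C by rewrite /m normc_def.
have [y _ ymax] := arg_maxP (fun y => m (u y) / v y) (erefl (y0 \in Y)).
rewrite mE lecR; set c := m (u y) / v y in ymax.
have mu x : m (u x) <= c * v x by rewrite -ler_pdivrMr //; exact: ymax.
have c0 : 0 < c.
  have : 0 < m (u y0) by rewrite -[_ < _]ltcR -mE normr_gt0.
  by move=> /lt_le_trans /(_ (mu y0)); rewrite pmulr_lgt0.
have muE : m (u y) = c * v y by rewrite divfK ?gt_eqF.
have cv0 : 0 < c * v y by rewrite mulr_gt0.
rewrite -(ler_pM2r cv0) -{1}muE [leRHS]mulrCA -Av mulr_sumr.
rewrite -lecR rmorphM /= -!mE -normrM -Au (le_trans (ler_norm_sum _ _ _)) //.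
rewrite raddf_sum; apply: ler_sum => z _.
rewrite normrM normc_def /= expr0n addr0 sqrtr_sqr ger0_norm ?Fplus_ge0// mE.
by rewrite -rmorphM /= lecR mulrCA ler_wpM2l ?Fplus_ge0.
Qed.

(** Both [r] and the chosen root are eigenvalues that dominate every eigenvalue in modulus, so each
    bounds the other. *)
Lemma PF_rootE r v (y0 : Y) : (forall y, 0 < v y) ->
  (forall y, app v y = r * v y) -> PF_root A = r.
Proof.
move=> v0 Av.
have rP : is_PF_root A r.
  split; last exact: complex_eigenvalue_le v0 Av.
  exists (fun y => (v y)%:C%C).
    by exists y0; rewrite gt_eqF // ltcR.
  move=> y; rewrite -rmorphM /= -Av raddf_sum.
  by apply: eq_bigr => z _; rewrite -rmorphM.
have [le_l le_r] : is_PF_root A (PF_root A) by apply: xgetPex; exists r.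
have r0 : 0 <= r.
  rewrite -(pmulr_lge0 _ (v0 y0)) -Av.
  by apply: app_ge0 => y; apply: ltW.
have := rP.2 _ le_l; have := le_r _ rP.1.
rewrite !normc_def /= !expr0n !addr0 !sqrtr_sqr !lecR ger0_norm // => h1 h2.
by apply/le_anti; rewrite h1 (le_trans (ler_norm _) h2).
Qed.


(* Maximise [r] over the compact set of pairs [(r, v)] with [v] in the simplex,
   encoded as functions on [option Y] so that Tychonoff's theorem applies. *)
Lemma max_subinvariant (y0 : Y) : exists r v,
  [/\ 0 <= r, forall y, 0 <= v y, \sum_y v y = 1,
      forall y, r * v y <= app v y &
      forall r' v', 0 <= r' -> (forall y, 0 <= v' y) -> \sum_y v' y = 1 ->
        (forall y, r' * v' y <= app v' y) -> r' <= r].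
Proof.
(* [M] bounds every admissible [r]: sum [r * v y <= app v y] over [y], where [v] has total 1 and
   entries at most 1. *)
pose M := \sum_y \sum_y' A y y'.
pose bnd (i : option Y) : R := if i is Some _ then 1 else M.
pose T := prod_topology (fun _ : option Y => R).
pose K : set T := [set f | forall i, `[0, bnd i]%classic (f i)]%classic.
have cK : compact K.
  apply: (@tychonoff _ (fun=> R) (fun i => `[0, bnd i]%classic)) => i.
  exact: segment_compact.
pose rT (f : T) := f None; pose vT (f : T) y := f (Some y).
have cr : continuous rT by exact: (@proj_continuous _ (fun=> R) None).
have cv y : continuous (vT^~ y) by exact: (@proj_continuous _ (fun=> R) (Some y)).
have csum (F : Y -> T -> R) :
    (forall y, continuous (F y)) -> continuous (fun f => \sum_y F y f).
  by move=> cF; apply: continuous_big => //; exact: add_continuous.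
have capp y : continuous (fun f => app (vT f) y).
  apply: csum => y' f.
  apply: (@cvgM R T (nbhs f) _ (fun=> A y y') (fun f => vT f y')).
    exact: cvg_cst.
  exact: cv.
have crv y : continuous (fun f => rT f * vT f y).
  move=> f; apply: (@cvgM R T (nbhs f) _ rT (fun f => vT f y)).
    exact: cr.
  exact: cv.
(* The normalisation is split into two inequalities so that [closed_le_continuous] covers every
   constraint. *)
pose C : set T := [set f | [/\ forall y, rT f * vT f y <= app (vT f) y,
  \sum_y vT f y <= 1 & 1 <= \sum_y vT f y]]%classic.
have closedC : closed C.
  rewrite (_ : C = (\bigcap_y [set f | rT f * vT f y <= app (vT f) y]) `&`
     [set f | \sum_y vT f y <= 1] `&` [set f | 1 <= \sum_y vT f y])%classic.
    apply: closedI; last first.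
      by apply: closed_le_continuous; [exact: cst_continuous|exact: csum].
    apply: closedI; last first.
      by apply: closed_le_continuous; [exact: csum|exact: cst_continuous].
    by apply: closed_bigI => y _; exact: closed_le_continuous.
  apply/seteqP; split=> f /=; first by
    case=> h1 h2 h3; split=> //; split=> // y _; exact: h1.
  by case=> -[h1 h2] h3; split=> // y; exact: h1.
pose mk r v : T := fun i => if i is Some y then v y else r.
have mkP r v : 0 <= r -> (forall y, 0 <= v y) -> \sum_y v y = 1 ->
    (forall y, r * v y <= app v y) -> (K `&` C)%classic (mk r v).
  move=> r0 v0 v1 rv; split; last by split; rewrite // /vT /= v1.
  have vle1 y : v y <= 1.
    by rewrite -v1 (bigD1 y) //= lerDl; apply: sumr_ge0 => z _.
  move=> [y|] /=; rewrite in_itv /= ?v0 ?vle1 // r0 /=.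
  rewrite -[r]mulr1 -v1 mulr_sumr (le_trans (ler_sum _ (fun y _ => rv y))) //.
  apply: ler_sum => y _; apply: ler_sum => y' _.
  by rewrite ler_piMr ?Fplus_ge0.
have [|||f fKC fmax] := @compact_EVT_max T R rT (K `&` C)%classic.
- exists (mk 0 (fun y => (y == y0)%:R)); apply: mkP => //.
    by rewrite (bigD1 y0) //= eqxx big1 ?addr0 // => y /negPf ->.
  by move=> y; rewrite mul0r; apply: app_ge0.
- exact: compact_closedI.
- exact: continuous_subspaceT.
have [Kf [rv vle vge]] := set_mem fKC.
exists (rT f), (vT f); split=> //.
- by have := Kf None; rewrite /= in_itv => /andP[].
- by move=> y; have := Kf (Some y); rewrite /= in_itv => /andP[].
- by apply/le_anti; rewrite vle vge.
move=> r' v' r'0 v'0 v'1 rv'.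
by apply: (fmax (mk r' v')); apply/mem_set; exact: mkP.
Qed.

(* If [A v >= r v] were not an equality, then iterating [1 + A], which commutes
   with [A], would make the inequality strict at every vertex, so that [r] could
   be increased. *)
Let step w : Y -> R := fun y => w y + app w y.

Let iter_step_ge0 n w : (forall y, 0 <= w y) -> forall y, 0 <= iter n step w y.
Proof. by move=> w0; elim: n => //= n IH y; rewrite addr_ge0 ?app_ge0. Qed.

(** A vertex is positive after as many steps as a path from it to [y0] has edges, and the summand
    [w] in [step] keeps it so; the maximum of these lengths serves all vertices. *)
Let iter_step_gt0 w y0 : (forall y, 0 <= w y) -> 0 < w y0 ->
  exists n, forall y, 0 < iter n step w y.
Proof.
move=> w0 wy0.
have pos y : exists k, forall m, (k <= m)%N -> 0 < iter m step w y.
  have /connectP[p py y0E] := E_conn y y0; exists (size p).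
  elim: p y py y0E => [|y' p IH] y /=.
    by move=> _ <-; elim=> //= m IH _; rewrite ltr_pwDl ?IH // app_ge0 //;
      exact: iter_step_ge0.
  case/andP=> Eyy' py' y0E [//|m] /=; rewrite ltnS => /(IH _ py' y0E) m0.
  by rewrite ltr_wpDl ?iter_step_ge0 // (app_gt0 _ Eyy') //;
    exact: iter_step_ge0.
have [k kP] := fin_all_exists pos.
by exists (\max_y k y)%N => y; apply: kP; exact: leq_bigmax.
Qed.

Let defect r w : Y -> R := fun y => app w y - r * w y.

Let defect_step r n w : defect r (iter n step w) = iter n step (defect r w).
Proof.
elim: n w => //= n IH w; rewrite -IH; apply/funext => y.
move: (iter n step w) => {}w; rewrite /defect /step /app.
rewrite [X in _ = _ + X](_ : _ =
  (\sum_y' A y y' * app w y') - r * \sum_y' A y y' * w y'); last first.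
  by rewrite mulr_sumr -sumrB; apply: eq_bigr => z _; rewrite /app; ring.
under eq_bigr do rewrite mulrDr.
by rewrite big_split /= /app; ring.
Qed.

Lemma PF_exists (y0 : Y) : exists r v, (forall y, 0 < v y) /\
  forall y, app v y = r * v y.
Proof.
have [r [v [r0 v0 v1 rv rmax]]] := max_subinvariant y0.
have d0 y : 0 <= defect r v y by rewrite subr_ge0.
have vn0 : exists y, v y != 0.
  apply/not_existsP => v_eq0; have := v1; rewrite big1 => [/esym/eqP|y _].
    by rewrite oner_eq0.
  by apply/eqP/negP => h; apply: (v_eq0 y); apply/negP.
have [Av|/existsNP[y1 /eqP]] := pselect (forall y, app v y = r * v y).
  by exists r, v; split=> //; exact: eigenvector_pos Av vn0.
rewrite -subr_eq0 => dy1.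
have {}dy1 : 0 < defect r v y1 by rewrite lt_def dy1 d0.
have [n npos] := iter_step_gt0 d0 dy1.
pose z := iter n step v.
have z0 y : 0 <= z y by exact: iter_step_ge0.
have dz0 y : 0 < defect r z y by rewrite defect_step.
pose s := \sum_y z y.
have s0 : 0 < s.
  rewrite lt_def sumr_ge0 // andbT; apply/negP => /eqP/psumr_eq0P zE.
  have := dz0 y0; rewrite /defect /app zE // big1 ?mulr0 ?subr0 ?ltxx // => y _.
  by rewrite zE ?mulr0.
have [y _ ymin] := arg_minP (defect r z) (erefl (y0 \in Y)).
(* The increment is the least defect divided by the total mass [s]. Since [z x / s <= 1],
   multiplying it by [z x] gives at most the least defect, so [z / s] is admissible for the larger
   value, against the maximality of [r]. *)
have e0 : 0 < defect r z y / s by rewrite divr_gt0.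
suff : r + defect r z y / s <= r by rewrite leNgt ltrDl e0.
apply: (rmax _ (fun y => z y / s)) => [|x||x].
- by rewrite addr_ge0 // ltW.
- by rewrite divr_ge0 // ltW.
- by rewrite -mulr_suml divff // gt_eqF.
rewrite /app; under eq_bigr do rewrite mulrA.
rewrite -mulr_suml mulrA ler_pM2r ?invr_gt0 // mulrDl -lerBrDl.
apply: le_trans (ymin x _); last by [].
rewrite mulrAC -mulrA ler_piMr ?(ltW (dz0 _)) // ler_pdivrMr // mul1r.
by rewrite /s (bigD1 x) //= lerDl sumr_ge0.
Qed.


(** Any positive eigenpair computes the rescaling: [PF_rootE] fixes the root, and the chosen vector
    differs from [v] by a factor that cancels. *)
Lemma stoch_rescalingE r v : (forall y, 0 < v y) ->
  (forall y, app v y = r * v y) ->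
  stoch_rescaling A = fun y y' => A y y' * v y' / (r * v y).
Proof.
move=> v0 Av; apply/funext => y; apply/funext => y'.
have rE := PF_rootE y v0 Av.
have [w0 Aw] : is_PF_vector A (PF_vector A).
  by apply: xgetPex; exists v; split=> // z; rewrite rE; exact: Av.
rewrite rE in Aw.
have [c c0 wE] := eigenvector_unique v0 w0 Av Aw.
rewrite /stoch_rescaling rE !wE !invfM !mulrA.
rewrite [X in X / v y](_ : _ = A y y' * v y' / r * (c / c)); last by ring.
by rewrite divff ?mulr1 // gt_eqF.
Qed.

Hypothesis Y_gt1 : (1 < #|Y|)%N.

Lemma strongly_connected_out_edge y : exists y', E y y'.
Proof.
have [z zy] : exists z, z != y.
  have [z zy|h] := pickP (predC1 y); first by exists z.
  by move: Y_gt1; rewrite -subn_gt0 subn1 -(cardC1 y) (eq_card0 h).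
have /connectP[[|y' p]] := E_conn y z; first by move=> _ zE; rewrite zE eqxx in zy.
by case/andP=> Eyy' _ _; exists y'.
Qed.

(** An edge out of [y0] makes [app v y0 = r * v y0] positive. *)
Lemma PF_exists_gt0 : exists r v, [/\ 0 < r, forall y, 0 < v y &
  forall y, app v y = r * v y].
Proof.
have [y0 _] : exists y0 : Y, true.
  by case: (pickP (mem Y)) Y_gt1 => [y|/eq_card0 ->] //; exists y.
have [r [v [v0 Av]]] := PF_exists y0; exists r, v; split=> //.
have [y' Ey] := strongly_connected_out_edge y0.
by rewrite -(pmulr_lgt0 _ (v0 y0)) -Av; apply: (app_gt0 _ Ey) => // y; exact: ltW.
Qed.

End PerronFrobenius.

(** * Gauge changes, that is, scaling by [c] and conjugation by the diagonal matrix of [f] *)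

Definition gauge (R : realType) (Y : finType) (c : R) (f : Y -> R)
    (A : Y -> Y -> R) : Y -> Y -> R :=
  fun y y' => c * (A y y' * f y' / f y).

Section Rescaling.
Variables (R : realType) (Y : finType) (E : rel Y).
Hypotheses (E_conn : strongly_connected E) (Y_gt1 : (1 < #|Y|)%N).
Implicit Types (A : Y -> Y -> R) (f : Y -> R) (c : R).

Lemma Fplus_gauge c f A : 0 < c -> (forall y, 0 < f y) ->
  Fplus E A -> Fplus E (gauge c f A).
Proof.
move=> c0 f0 [A0 An]; split=> y y' Eyy'; rewrite /gauge.
  by rewrite mulr_gt0 // divr_gt0 // mulr_gt0 // A0.
by rewrite An // !mul0r mulr0.
Qed.

Lemma stoch_rescaling_is_gauge A : Fplus E A ->
  exists c f, [/\ 0 < c, forall y, 0 < f y & stoch_rescaling A = gauge c f A].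
Proof.
move=> FA; have [r [v [r0 v0 Av]]] := PF_exists_gt0 E_conn FA Y_gt1.
exists r^-1, v; split; rewrite ?invr_gt0 // (stoch_rescalingE E_conn FA v0 Av).
apply/funext => y; apply/funext => y'; rewrite /gauge invfM; ring.
Qed.

(** If [v] is an eigenvector of [A] for [r], then [v / f] is one of [gauge c f A] for [c * r]; in
    the rescaling [c] and [f] cancel. *)
Lemma stoch_rescaling_gauge c f A : 0 < c -> (forall y, 0 < f y) ->
  Fplus E A -> stoch_rescaling (gauge c f A) = stoch_rescaling A.
Proof.
move=> c0 f0 FA; have [r [v [r0 v0 Av]]] := PF_exists_gt0 E_conn FA Y_gt1.
have nz y : f y != 0 by rewrite gt_eqF.
have w0 y : 0 < v y / f y by rewrite divr_gt0.
have Aw y : \sum_y' gauge c f A y y' * (v y' / f y') = (c * r) * (v y / f y).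
  rewrite [RHS](_ : _ = c / f y * (r * v y)); last by ring.
  rewrite -Av mulr_sumr; apply: eq_bigr => z _.
  by rewrite /gauge; field; rewrite !nz.
rewrite (stoch_rescalingE E_conn (Fplus_gauge c0 f0 FA) w0 Aw).
rewrite (stoch_rescalingE E_conn FA v0 Av).
apply/funext => y; apply/funext => y'; rewrite /gauge.
by field; rewrite !nz !gt_eqF.
Qed.

End Rescaling.

(** * Weighted geometric means: idempotent and multiplicative on positive reals *)

Section GeometricMean.
Variables (R : realType) (t : R).
Implicit Types a b : R.

Definition geom a b : R := a `^ (1 - t) * b `^ t.

Lemma geom_gt0 a b : 0 < a -> 0 < b -> 0 < geom a b.
Proof. by move=> a0 b0; rewrite mulr_gt0 ?powR_gt0. Qed.

Lemma geom_id a : 0 < a -> geom a a = a.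
Proof.
move=> a0; rewrite /geom -powRD ?subrK ?powRr1 ?ltW //.
by rewrite gt_eqF ?implybT.
Qed.

Lemma geomM a a' b b' : 0 < a -> 0 < a' -> 0 < b -> 0 < b' ->
  geom (a * a') (b * b') = geom a b * geom a' b'.
Proof. by move=> *; rewrite /geom !powRM ?ltW //; ring. Qed.

Lemma geomV a b : 0 < a -> 0 < b -> geom a^-1 b^-1 = (geom a b)^-1.
Proof.
move=> a0 b0; apply: (mulIf (lt0r_neq0 (geom_gt0 a0 b0))).
rewrite -geomM ?invr_gt0 // !mulVf ?gt_eqF ?geom_id //.
exact: geom_gt0.
Qed.

End GeometricMean.

(** * Affinity along e-geodesics *)

Lemma lumped_strongly_connected (Y X : finType) (E : rel Y) (k : Y -> X) :
  strongly_connected E -> lumping_function k ->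
  strongly_connected (lumped_edges k E).
Proof.
move=> E_conn k_surj x x'; have [[y <-] [y' <-]] := (k_surj x, k_surj x').
have /connectP[p] := E_conn y y'; elim: p y => [|z p IH] y /=.
  by move=> _ ->; exact: connect0.
case/andP=> Eyz pz /(IH _ pz); apply: connect_trans; apply: connect1.
by apply/existsP; exists y; apply/existsP; exists z; rewrite Eyz !eqxx.
Qed.

Lemma exp_embedding_e_geodesic_affine (R : realType) (Y X : finType)
    (E : rel Y) (k : Y -> X) (Po : Y -> Y -> R) :
  (1 < #|Y|)%N -> (1 < #|X|)%N -> strongly_connected E ->
  lumping_function k -> Fplus E Po ->
  e_geodesic_affine (lumped_edges k E) E (exp_embedding k Po).
Proof.
move=> Y1 X1 E_conn k_surj FPo P0 P1 [FP0 _] [FP1 _] t.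
have D_conn := lumped_strongly_connected E_conn k_surj.
set D := lumped_edges k E in FP0 FP1 D_conn *.
have ED y y' : E y y' -> D (k y) (k y').
  by move=> Eyy'; apply/existsP; exists y; apply/existsP; exists y';
    rewrite Eyy' !eqxx.
have Flift (P : X -> X -> R) :
    Fplus D P -> Fplus E (fun y y' => Po y y' * P (k y) (k y')).
  case: FPo => Po0 Pon [P_gt0 _]; split=> y y' Eyy'.
    by rewrite mulr_gt0 ?Po0 ?P_gt0 ?ED.
  by rewrite Pon ?mul0r.
pose B x x' := if D x x' then geom t (P0 x x') (P1 x x') else 0.
have FB : Fplus D B.
  split=> x x'; last by rewrite /B => /negPf ->.
  by move=> Dxx'; rewrite /B Dxx' geom_gt0 ?FP0.1 ?FP1.1.
have FC := Flift _ FB.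
rewrite /e_geodesic /exp_embedding -/(B).
have [c [f [c0 f0 ->]]] := stoch_rescaling_is_gauge D_conn X1 FB.
have [a [g [a0 g0 ->]]] :=
  stoch_rescaling_is_gauge E_conn Y1 (Flift _ FP0).
have [b [h [b0 h0 ->]]] :=
  stoch_rescaling_is_gauge E_conn Y1 (Flift _ FP1).
(* Both sides rescale a gauge change of this matrix: on the left by [c] and [f] composed with [k],
   on the right by the geometric means of the gauges of the two endpoints. *)
transitivity (stoch_rescaling (fun y y' => Po y y' * B (k y) (k y'))).
  rewrite -(stoch_rescaling_gauge E_conn Y1 c0 (fun y => f0 (k y)) FC).
  congr stoch_rescaling; apply/funext => y; apply/funext => y'.
  by rewrite /gauge; ring.
rewrite -(stoch_rescaling_gauge E_conn Y1 (geom_gt0 t a0 b0)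
  (fun y => geom_gt0 t (g0 y) (h0 y)) FC).
congr stoch_rescaling; apply/funext => y; apply/funext => y'.
have [Eyy'|nE] := boolP (E y y'); last by rewrite /gauge FPo.2 ?mul0r ?mulr0.
have Po0 := FPo.1 _ _ Eyy'.
have P00 := FP0.1 _ _ (ED _ _ Eyy'); have P10 := FP1.1 _ _ (ED _ _ Eyy').
(* The origin is common to both endpoints, so it is written as its own geometric mean before
   everything is merged by multiplicativity. *)
rewrite -/(geom t _ _) /gauge /B ED // -{1}(geom_id t Po0).
by rewrite -!(geomM, geomV) ?(mulr_gt0, invr_gt0).
Qed.

(* The counterexample lives on the complete digraph on two vertices with
   [k = id]: there [exp_embedding] maps the symmetric chain of holding
   probability [p] to the one of holding probability
   [a p / (a p + (1 - a) (1 - p))], which is not affine in [p] unless [a = 1/2]. *)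
Section SymmetricChain.
Variable R : realType.
Implicit Types p a : R.

Let E : rel bool := fun _ _ => true.

Definition sym_chain p (x y : bool) : R := if x == y then p else 1 - p.

Lemma bool_strongly_connected : strongly_connected E.
Proof. by move=> x y; exact: connect1. Qed.

Lemma lumped_edges_id : lumped_edges id E = E.
Proof.
apply/funext => x; apply/funext => y; apply/existsP.
by exists x; apply/existsP; exists y; rewrite !eqxx.
Qed.

Lemma sym_chain_W p : 0 < p < 1 -> W E (sym_chain p).
Proof.
move=> p01; split; last by case; rewrite big_bool /sym_chain /=; lra.
by split=> // x y _; rewrite /sym_chain; case: ifP => _; lra.
Qed.

Lemma sym_chain_edge_measure p : 0 < p < 1 ->
  edge_measure (sym_chain p) = fun x y => sym_chain p x y / 2.
Proof.
move=> p01; apply/funext => x; apply/funext => y.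
rewrite /edge_measure mulrC; congr (_ * _).
have [s0] : is_stationary (sym_chain p) (stationary (sym_chain p)).
  apply: xgetPex; exists (fun=> 2^-1); split.
  - by move=> _; rewrite invr_ge0.
  - by rewrite big_bool /=; lra.
  - by case; rewrite big_bool /sym_chain /=; lra.
rewrite big_bool /= => s1 /(_ true); rewrite big_bool /sym_chain /= => st.
(* Stationarity at [true], rearranged; as [p < 1], the stationary distribution is uniform. *)
have : (1 - p) * (stationary (sym_chain p) true -
  stationary (sym_chain p) false) = 0 by rewrite /sym_chain; lra.
move/eqP; rewrite mulf_eq0 => /orP[/eqP|/eqP]; first lra.
by case: x; rewrite /sym_chain in s1 *; lra.
Qed.

Lemma sym_chain_m_geodesic p0 p1 t : 0 < p0 < 1 -> 0 < p1 < 1 ->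
  0 < (1 - t) * p0 + t * p1 < 1 ->
  m_geodesic E (sym_chain p0) (sym_chain p1) t =
  sym_chain ((1 - t) * p0 + t * p1).
Proof.
move=> h0 h1 h; set p := _ + _ in h *.
have segE : m_segment (sym_chain p0) (sym_chain p1) t =
    fun x y => sym_chain p x y / 2.
  apply/funext => x; apply/funext => y.
  rewrite /m_segment !sym_chain_edge_measure // /sym_chain /p.
  by case: ifP => _; lra.
have [[_ P1] PQ] : W E (m_geodesic E (sym_chain p0) (sym_chain p1) t) /\
    edge_measure (m_geodesic E (sym_chain p0) (sym_chain p1) t) =
    m_segment (sym_chain p0) (sym_chain p1) t.
  apply: (xgetPex (fun _ _ => 0) (P := fun P => W E P /\ edge_measure P = _)).
  exists (sym_chain p); split; first exact: sym_chain_W.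
  by rewrite segE sym_chain_edge_measure.
set P := m_geodesic _ _ _ _ in P1 PQ *.
have PQE x y : stationary P x * P x y = sym_chain p x y / 2.
  by have := congr1 (fun Q : bool -> bool -> R => Q x y) PQ; rewrite segE.
(* The rows of [P] sum to 1, so the row sums of its edge measure recover its stationary
   distribution, and dividing by it determines [P]. *)
have st x : stationary P x = 2^-1.
  rewrite -[LHS]mulr1 -[X in _ * X](P1 x) mulr_sumr.
  under eq_bigr do rewrite PQE.
  by case: x; rewrite big_bool /sym_chain /=; lra.
by apply/funext => x; apply/funext => y; have := PQE x y; rewrite st; lra.
Qed.

Lemma sym_chain_exp_embedding a p : 0 < a < 1 -> 0 < p < 1 ->
  exp_embedding id (sym_chain a) (sym_chain p) =
  sym_chain (a * p / (a * p + (1 - a) * (1 - p))).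
Proof.
move=> a01 p01; rewrite /exp_embedding.
have ap : 0 < a * p by apply: mulr_gt0; lra.
have bq : 0 < (1 - a) * (1 - p) by apply: mulr_gt0; lra.
set A := fun _ _ => _; set r := _ + _.
have FA : Fplus E A.
  by split=> // x y _; rewrite /A /sym_chain; case: ifP.
have r0 : r != 0 by rewrite gt_eqF // addr_gt0.
(* Both rows of [A] sum to [r], so the constant vector 1 is a Perron-Frobenius eigenvector. *)
rewrite (@stoch_rescalingE _ _ E A bool_strongly_connected FA r (fun=> 1)) //.
  apply/funext => x; apply/funext => y; rewrite /A /sym_chain !mulr1.
  case: ifP => // _; rewrite -[1 in RHS](divff r0) -mulrBl.
  by congr (_ / _); rewrite /r; ring.
by case; rewrite big_bool /A /sym_chain /r /=; ring.
Qed.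

Lemma exp_embedding_not_m_geodesic_affine :
  ~ m_geodesic_affine (lumped_edges id E) E
      (exp_embedding id (sym_chain (2 / 3))).
Proof.
rewrite lumped_edges_id => aff.
have h2 : 0 < (2^-1 : R) < 1 by lra.
have h4 : 0 < (4^-1 : R) < 1 by lra.
have h23 : 0 < (2 / 3 : R) < 1 by lra.
have e2 : exp_embedding id (sym_chain (2 / 3)) (sym_chain 2^-1) =
    sym_chain (2 / 3) :> (bool -> bool -> R).
  by rewrite sym_chain_exp_embedding //; congr sym_chain; field.
have e4 : exp_embedding id (sym_chain (2 / 3)) (sym_chain 4^-1) =
    sym_chain (2 / 5) :> (bool -> bool -> R).
  by rewrite sym_chain_exp_embedding //; congr sym_chain; field.
have h25 : 0 < (2 / 5 : R) < 1 by lra.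
have dom p0 p1 : 0 < (p0 : R) < 1 -> 0 < (p1 : R) < 1 ->
    m_domain E (sym_chain p0) (sym_chain p1) 2^-1.
  move=> h0 h1 x y _; rewrite /m_segment !sym_chain_edge_measure //.
  by rewrite /sym_chain; case: ifP => _; lra.
have := aff _ _ (sym_chain_W h2) (sym_chain_W h4) 2^-1 (dom _ _ h2 h4).
rewrite e2 e4 => /(_ (dom _ _ h23 h25)).
rewrite sym_chain_m_geodesic //; last by lra.
rewrite sym_chain_m_geodesic //; last by lra.
rewrite sym_chain_exp_embedding //; last by lra.
(* The midpoint 3/8 of 1/2 and 1/4 is sent to 6/11, whereas the midpoint of the images 2/3 and 2/5
   is 8/15. *)
move/(congr1 (fun P : bool -> bool -> R => P true true)); rewrite /sym_chain /=.
rewrite [LHS](_ : _ = 6 / 11); last by field.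
lra.
Qed.

End SymmetricChain.

Theorem theorem4p2 (R : realType) :
  (forall (Y X : finType) (E : rel Y) (k : Y -> X) (Po : Y -> Y -> R),
     (1 < #|Y|)%N -> (1 < #|X|)%N ->
     strongly_connected E -> lumping_function k -> W_lumpable k E Po ->
     e_geodesic_affine (lumped_edges k E) E (exp_embedding k Po))
  /\
  (exists (Y X : finType) (E : rel Y) (k : Y -> X) (Po : Y -> Y -> R),
     [/\ (1 < #|Y|)%N, (1 < #|X|)%N, strongly_connected E &
         lumping_function k] /\
     W_lumpable k E Po /\
     ~ m_geodesic_affine (lumped_edges k E) E (exp_embedding k Po)).
Proof.
split.
  move=> Y X E k Po Y1 X1 E_conn k_surj [[FPo _] _].
  exact: exp_embedding_e_geodesic_affine.
exists bool, bool, (fun _ _ => true), id, (sym_chain (2 / 3 : R)).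
split; first by rewrite card_bool; split=> //;
  [exact: bool_strongly_connected|move=> x; exists x].
split; last exact: exp_embedding_not_m_geodesic_affine.
split; first by apply: sym_chain_W; lra.
(* The fibres of [id] are singletons, so [y1] and [y2] coincide. *)
by move=> x x' y1 y2; rewrite !inE => /eqP -> /eqP ->.
Qed.
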